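(* Let $(W,S)$ be a Coxeter system with Coxeter matrix $(m_{st})$, and let $T\subset S$ be such that for any $t\in T$ and $s\in S-T$ the exponent $m_{st}$ is even or $\infty$. Let $\overline{W_T}$ be the normal closure of $W_T$ in $W$, and let $S_T=\{wtw^{-1} : t\in T,\ w\in W_{S-T}\}$. Then: (1) there exists a well defined homomorphism $\phi_T\colon W\to W_{S-T}$ that is the identity on $W_{S-T}$ and sends $W_T$ to the identity element; (2) $\overline{W_T}$ is the kernel of $\phi_T$; (3) $\overline{W_T}$ is generated by $S_T$; (4) the Cayley graph $C_{\overline{W_T}}$ of $(\overline{W_T},S_T)$ is obtained from the Cayley graph $C_W$ of $(W,S)$ by collapsing all the edges marked by generators not in $T$; (5) $(\overline{W_T},S_T)$ is a Coxeter system.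
   Context: A Coxeter system $(W,S)$ is a group $W$ with a generating set $S$ and presentation $W=\langle S\mid (st)^{m_{st}}=1 \text{ for all } s,t\in S\rangle$, where $m_{ss}=1$ and $m_{st}=m_{ts}\in\{2,3,\dots,\infty\}$ for $s\ne t$ ($m_{st}=\infty$ means no relation). For $U\subset S$, $W_U$ is the subgroup generated by $U$ (a standard parabolic subgroup). For a group $G$ generated by a set $X$ of involutions, the Cayley graph of $(G,X)$ has vertex set $G$ and $\{g_1,g_2\}$ is an edge iff $g_1^{-1}g_2\in X$; this edge is marked by the generator $g_1^{-1}g_2$. The group acts on the left. Collapsing all edges marked by generators not in $T$ identifies the vertices in each left coset $wW_{S-T}$; the resulting graph is regarded as a simple graph (parallel edges identified), and the coset $gW_{S-T}$ with $g\in\overline{W_T}$ is identified with the vertex $g$ of $C_{\overline{W_T}}$. *)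

(* Defs.v *)
From HB Require Import structures.
From mathcomp Require Import all_boot.
From mathcomp Require Import boolp classical_sets functions.
From Stdlib Require Import Relation_Operators.

Set Implicit Arguments.
Unset Strict Implicit.
Unset Printing Implicit Defensive.

Local Open Scope classical_set_scope.
Local Open Scope group_scope.

(* A subgroup of a (possibly infinite) group is a [groupClosed] predicate.
   [gen A] is the subgroup generated by [A], so that W_U is [gen U];
   [ncl A] is the normal closure of [A]. *)
Section Subgroups.
Variable G : groupType.
Implicit Types (A : set G) (N : groupClosed G).

Definition gen A : {pred G} :=
  mem [set x | forall H : groupClosed G, A `<=` [set` H] -> x \in H].

Lemma genP A x :
  reflect (forall H : groupClosed G, A `<=` [set` H] -> x \in H) (x \in gen A).
Proof. by apply: (iffP idP) => [/set_mem|Ax]; last exact: mem_set. Qed.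

Fact gen_mulg_closed A : mulg_closed (gen A).
Proof.
move=> x y /genP Hx /genP Hy; apply/genP => H AH.
by rewrite gpredM ?Hx ?Hy.
Qed.
Fact gen_group1 A : 1 \in gen A.
Proof. by apply/genP => H _; apply: gpred1. Qed.
Fact gen_invg_closed A : invg_closed (gen A).
Proof. by move=> x /genP Hx; apply/genP => H AH; rewrite gpredVr ?Hx. Qed.

HB.instance Definition _ A := isMulClosed.Build G (gen A) (@gen_mulg_closed A).
HB.instance Definition _ A := isMul1Closed.Build G (gen A) (@gen_group1 A).
HB.instance Definition _ A := isInvClosed.Build G (gen A) (@gen_invg_closed A).

Definition normal_subgroup N : Prop :=
  forall g x, x \in N -> g * x * g^-1 \in N.

Definition ncl A : {pred G} :=
  mem [set x | forall N, normal_subgroup N -> A `<=` [set` N] -> x \in N].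

Lemma nclP A x :
  reflect (forall N, normal_subgroup N -> A `<=` [set` N] -> x \in N)
          (x \in ncl A).
Proof. by apply: (iffP idP) => [/set_mem|Ax]; last exact: mem_set. Qed.

Fact ncl_mulg_closed A : mulg_closed (ncl A).
Proof.
move=> x y /nclP Hx /nclP Hy; apply/nclP => N nN AN.
by rewrite gpredM ?Hx ?Hy.
Qed.
Fact ncl_group1 A : 1 \in ncl A.
Proof. by apply/nclP => N _ _; apply: gpred1. Qed.
Fact ncl_invg_closed A : invg_closed (ncl A).
Proof. by move=> x /nclP Hx; apply/nclP => N nN AN; rewrite gpredVr ?Hx. Qed.

HB.instance Definition _ A := isMulClosed.Build G (ncl A) (@ncl_mulg_closed A).
HB.instance Definition _ A := isMul1Closed.Build G (ncl A) (@ncl_group1 A).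
HB.instance Definition _ A := isInvClosed.Build G (ncl A) (@ncl_invg_closed A).

Definition lcoset (g : G) (H : groupClosed G) : set G :=
  [set g * h | h in [set` H]].

End Subgroups.

Record subgroup_type (G : groupType) (H : groupClosed G) := SubgroupElt {
  sgval : G;
  _ : sgval \in H }.

HB.instance Definition _ G H := [isSub for @sgval G H].
HB.instance Definition _ (G : groupType) (H : groupClosed G) :=
  [Choice of subgroup_type H by <:].
Fact subgroup_type_closed (G : groupType) (H : groupClosed G) :
  group_closed [pred x : G | x \in H].
Proof. by split; [exact: gpred1 | exact: gpredF]. Qed.

HB.instance Definition _ (G : groupType) (H : groupClosed G) :=
  SubChoice_isSubGroup.Build G _ (subgroup_type H) (@subgroup_type_closed G H).

(* Words over the letters i and i^-1 (encoded as (i, false) and (i, true)).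
   [pres_eq R] is the least congruence containing the free cancellations and
   killing the relators in [R], so that the words modulo [pres_eq R] form the
   group <I | R>. *)
Definition word (I : Type) := seq (I * bool).

Inductive pres_eq (I : Type) (R : set (word I)) : word I -> word I -> Prop :=
| pres_refl u : pres_eq R u u
| pres_sym u v : pres_eq R u v -> pres_eq R v u
| pres_trans u v w : pres_eq R u v -> pres_eq R v w -> pres_eq R u w
| pres_cat u u' v v' :
    pres_eq R u u' -> pres_eq R v v' -> pres_eq R (u ++ v) (u' ++ v')
| pres_cancel i b : pres_eq R [:: (i, b); (i, ~~ b)] [::]
| pres_relator r : R r -> pres_eq R r [::].

Definition eval_word (I : Type) (G : groupType) (f : I -> G) (w : word I) : G :=
  \prod_(a <- w) (if a.2 then (f a.1)^-1 else f a.1).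

(* G = <I | R>, where i : I stands for f i : G. *)
Definition presentation (I : Type) (G : groupType) (f : I -> G)
    (R : set (word I)) : Prop :=
  (forall g : G, exists w, eval_word f w = g) /\
  (forall w, eval_word f w = 1 <-> pres_eq R w [::]).

(* The exponent infinity is encoded as [None]. *)
Definition coxeter_matrix (I : Type) (m : I -> I -> option nat) : Prop :=
  [/\ forall s, m s s = Some 1%N,
      forall s t, m s t = m t s &
      forall s t, s <> t -> if m s t is Some k then (2 <= k)%N else true].

Definition coxeter_relators (I : Type) (m : I -> I -> option nat) :
    set (word I) :=
  [set r | exists s t k,
     m s t = Some k /\ r = flatten (nseq k [:: (s, false); (t, false)])].

Definition coxeter_system_of (W : groupType) (S : set W)
    (m : S -> S -> option nat) : Prop :=
  coxeter_matrix m /\ presentation (fun s : S => val s) (coxeter_relators m).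

Definition coxeter_system (W : groupType) (S : set W) : Prop :=
  exists m : S -> S -> option nat, coxeter_system_of m.

Definition even_or_infinite (k : option nat) : bool :=
  if k is Some n then ~~ odd n else true.

(* [edge x y c]: there is an edge marked by c between x and y.  For a Cayley
   graph this is symmetric in x and y as soon as the generators are
   involutions. *)
Record marked_graph (V M : Type) := MarkedGraph {
  vertices : set V;
  edge : V -> V -> M -> Prop }.

Definition cayley (G : groupType) (X : set G) : marked_graph G G :=
  MarkedGraph [set: G] (fun g1 g2 x => X x /\ g1^-1 * g2 = x).

(* Collapsing the edges whose mark lies in [C]: the new vertices are the classes
   of the equivalence relation generated by the collapsed edges, and the
   remaining edges survive, joining the classes of their ends.  Loops are not
   discarded. *)
Section Collapse.
Variables (V M : Type) (C : set M) (g : marked_graph V M).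

Definition collapse_class (v : V) : set V :=
  [set u | clos_refl_sym_trans V
             (fun x y => [/\ vertices g x, vertices g y &
                             exists2 c, C c & edge g x y c]) v u].

Definition collapse : marked_graph (set V) M :=
  MarkedGraph (collapse_class @` vertices g)
    (fun A B c => ~ C c /\ exists x y, [/\ A x, B y & edge g x y c]).

End Collapse.

(* Adjacency in the underlying graph: marks are forgotten and parallel edges
   identified. *)
Definition adjacent (V M : Type) (g : marked_graph V M) (x y : V) : Prop :=
  exists c, edge g x y c.

Definition graph_isomorphism (V1 M1 V2 M2 : Type) (g1 : marked_graph V1 M1)
    (g2 : marked_graph V2 M2) (f : V1 -> V2) : Prop :=
  set_bij (vertices g1) (vertices g2) f /\
  (forall x y, vertices g1 x -> vertices g1 y ->
     (adjacent g1 x y <-> adjacent g2 (f x) (f y))).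

Definition conj_gens (W : groupType) (S T : set W) : set W :=
  [set w * t * w^-1 | w in [set` gen (S `\` T)] & t in T].

(* Main.v *)
Require Import Defs.
From HB Require Import structures.
From mathcomp Require Import all_boot.
From mathcomp Require Import boolp classical_sets functions.
From Stdlib Require Import Relation_Operators.

(** Write P for W_{S-T}, N for the normal closure of W_T and S_T for the set of
    the conjugates p t p^-1 with p in P and t in T.

    Sending every t in T to 1 and fixing every s outside T respects the Coxeter
    relators: only a mixed relator (s t)^k needs an argument, and it becomes s^k,
    which is trivial because k is even and s is an involution.  This gives the
    retraction phi from W onto P ([retraction_exists]), and N lies in its kernel.

    Everything else comes from Reidemeister-Schreier rewriting.  Read a word u over
    S from left to right and keep track of the image p in P of the part already
    read; output p t p^-1 at each letter t of T, and nothing at the other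
    letters.  The result [schreier 1 u] is a word over S_T, and its value is
    u phi(u)^-1 ([eval_schreier]).  So an element of the kernel of phi is a product
    of elements of S_T, whence ker phi = N = <S_T>.

    For the Coxeter property, give the pair a, b of elements of S_T the exponent
    m'(a, b) := order of a b.  These relators hold in N, and it remains to see that
    they suffice.  Since (a b)^j can be reduced to the empty word as soon as it is 1
    in N, it is enough that the rewriting maps every relator (s t)^k of W to a word
    of the form (a b)^j or to the empty word ([schreier_relator]).  If s and t both
    lie in T this is clear, with j = k; if neither does, the output is empty; and if
    exactly one of them does, two consecutive occurrences of s t have trivial image
    in P and contribute two letters a, b, so the parity of k gives j = k/2.  Hence
    equivalent words over S have equivalent rewritings.  Now a word w over S_T is
    the rewriting of a word u over S: replace each letter p t p^-1 by a
    word for p, then t, then a word for p^-1.  If w is trivial in N, then u is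
    trivial in W, so u reduces to the empty word by means of the relators of W, and
    therefore w reduces to the empty word by means of the new ones.

    For the Cayley graphs, the classes of the collapsed graph are the cosets gP;
    each meets N in exactly one point, because W is the semidirect product of N and
    P.  For x, y in N the cosets xP and yP are joined by an edge marked t when
    x^-1 y = p t q^-1 with p, q in P, and applying phi forces p = q. *)

Set Implicit Arguments.
Unset Strict Implicit.
Unset Printing Implicit Defensive.

Local Open Scope classical_set_scope.
Local Open Scope group_scope.

(** * Induction principles for generated subgroups and normal closures *)

Section Generation.
Variables (G : groupType) (A : set G).

Lemma sub_gen : A `<=` [set` gen A].
Proof. by move=> x Ax; apply/genP => H; apply. Qed.

Lemma sub_ncl : A `<=` [set` ncl A].
Proof. by move=> x Ax; apply/nclP => H _; apply. Qed.

Lemma ncl_normal : normal_subgroup (ncl A : groupClosed G).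
Proof.
by move=> g x /nclP Nx; apply/nclP => N nN AN; exact/nN/Nx.
Qed.

(* Any property closed under the group operations is a subgroup, so the
   quantification over subgroups can be turned into an induction. *)
Variable Q : G -> Prop.
Hypothesis Q1 : Q 1.
Hypothesis QM : forall x y, Q x -> Q y -> Q (x * y).
Hypothesis QV : forall x, Q x -> Q x^-1.
Hypothesis AQ : forall x, A x -> Q x.

Let QS : {pred G} := mem [set x | Q x].

Fact pred_mulg_closed : mulg_closed QS.
Proof. by move=> x y /set_mem Qx /set_mem Qy; apply/mem_set/QM. Qed.
Fact pred_group1 : 1 \in QS. Proof. exact: mem_set. Qed.
Fact pred_invg_closed : invg_closed QS.
Proof. by move=> x /set_mem Qx; apply/mem_set/QV. Qed.

Let QG : groupClosed G := HB.pack QS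
  (isMulClosed.Build G QS pred_mulg_closed)
  (isMul1Closed.Build G QS pred_group1)
  (isInvClosed.Build G QS pred_invg_closed).

Lemma gen_ind x : x \in gen A -> Q x.
Proof.
move=> /genP/(_ QG) Qx; apply: set_mem; apply: Qx => y Ay.
exact/mem_set/AQ.
Qed.

Lemma ncl_ind x :
  (forall g y, Q y -> Q (g * y * g^-1)) -> x \in ncl A -> Q x.
Proof.
move=> QJ /nclP/(_ QG) Qx; apply: set_mem; apply: Qx => [g y /set_mem Qy|y Ay].
  exact/mem_set/QJ.
exact/mem_set/AQ.
Qed.

End Generation.

(** * Words and presentations *)

Section Words.
Variables (I : Type) (G : groupType).
Implicit Types (f : I -> G) (u v w : word I) (R : set (word I)).

Lemma eval_word_nil f : eval_word f [::] = 1.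
Proof. by rewrite /eval_word big_nil. Qed.

Lemma eval_word_cat f u v : eval_word f (u ++ v) = eval_word f u * eval_word f v.
Proof. by rewrite /eval_word big_cat. Qed.

Lemma eval_word1 f i b :
  eval_word f [:: (i, b)] = if b then (f i)^-1 else f i.
Proof. by rewrite /eval_word big_seq1. Qed.

Lemma eval_word_cons f a u : eval_word f (a :: u) = eval_word f [:: a] * eval_word f u.
Proof. by rewrite -eval_word_cat. Qed.

Lemma eval_word2 f i j : eval_word f [:: (i, false); (j, false)] = f i * f j.
Proof. by rewrite eval_word_cons !eval_word1. Qed.

Lemma eval_word_pow f u k :
  eval_word f (flatten (nseq k u)) = eval_word f u ^+ k.
Proof.
elim: k => [|k IHk]; first exact: eval_word_nil.
by rewrite /= eval_word_cat IHk expgS.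
Qed.

Lemma eval_word_cancel f i b : eval_word f [:: (i, b); (i, ~~ b)] = 1.
Proof.
by rewrite eval_word_cons !eval_word1; case: b; rewrite ?mulVg ?mulgV.
Qed.

Lemma eval_word_eq_pres f R u v :
  (forall r, R r -> eval_word f r = 1) ->
  pres_eq R u v -> eval_word f u = eval_word f v.
Proof.
move=> fR; elim=> {u v} [//|//|u v w _ -> _ ->//|u u' v v' _ + _ +|i b|r Rr].
- by rewrite !eval_word_cat => -> ->.
- by rewrite eval_word_cancel eval_word_nil.
- by rewrite fR ?eval_word_nil.
Qed.

Definition inv_word w : word I := rev [seq (a.1, ~~ a.2) | a <- w].

Lemma eval_inv_word f w : eval_word f (inv_word w) = (eval_word f w)^-1.
Proof.
elim: w => [|[i b] w IHw]; first by rewrite eval_word_nil invg1.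
rewrite /inv_word map_cons rev_cons -cats1 eval_word_cat -/(inv_word w) IHw.
rewrite [in RHS]eval_word_cons invgM !eval_word1.
by case: b; rewrite ?invgK.
Qed.

Lemma pres_eq_pow R u k :
  pres_eq R u [::] -> pres_eq R (flatten (nseq k u)) [::].
Proof.
move=> Ru; elim: k => [|k IHk]; first exact: pres_refl.
exact: (pres_cat Ru IHk).
Qed.

End Words.

(** The value of h on a word depends only on the element that it represents: if
    two words agree in G, then the first followed by the inverse of the second is
    killed by the relators.  So a choice of words for the elements of G yields a
    morphism. *)
Lemma presentation_lift (I : Type) (G H : groupType) (f : I -> G)
    (R : set (word I)) (h : I -> H) :
  presentation f R -> (forall r, R r -> eval_word h r = 1) ->
  exists phi : UMagmaMorphism.type G H, forall i, phi (f i) = h i.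
Proof.
move=> [fsurj frel] hR.
have [wd wdK] := choice fsurj.
have hwd g w : eval_word f w = g -> eval_word h (wd g) = eval_word h w.
  move=> fw; apply: divg1_eq; rewrite -eval_inv_word -eval_word_cat.
  rewrite -(eval_word_nil h); apply: (eval_word_eq_pres hR); apply/frel.
  by rewrite eval_word_cat eval_inv_word wdK fw mulgV.
pose phi g := eval_word h (wd g).
have phiM : {morph phi : x y / x * y}.
  move=> x y; rewrite /phi -eval_word_cat.
  by apply: hwd; rewrite eval_word_cat !wdK.
have phi1 : phi 1 = 1 by rewrite /phi (hwd _ [::]) eval_word_nil.
pose Phi : UMagmaMorphism.type G H := HB.pack phi
  (isMultiplicative.Build G H phi phiM)
  (Multiplicative_isUMagmaMorphism.Build G H phi phi1).
exists Phi => i.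
by rewrite /= /phi (hwd _ [:: (i, false)]) eval_word1.
Qed.

(** * Coxeter presentations whose exponents are the orders of the products *)

Lemma coxeter_involution (G : groupType) (X : set G) (m : X -> X -> option nat)
    (s : X) :
  coxeter_system_of m -> val s * val s = 1.
Proof.
move=> [[m1 _ _] [_ m_rel]]; rewrite -(eval_word2 (fun s : X => val s)).
by apply/m_rel/pres_relator; exists s, s, 1%N.
Qed.

(** Isolated from the notion of order so that two elements with the same
    annihilating exponents have the same order by congruence. *)
Definition least_opt (p : pred nat) : option nat :=
  if pselect (exists k, p k) is left ex then Some (ex_minn ex) else None.

Section Order.
Variable G : groupType.
Implicit Types x y : G.

Definition order_opt x : option nat :=
  least_opt (fun k => (0 < k)%N && (x ^+ k == 1)).

Lemma order_optP x k : order_opt x = Some k -> (0 < k)%N /\ x ^+ k = 1.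
Proof.
rewrite /order_opt /least_opt; case: pselect => // ex [<-].
by case: ex_minnP => n /andP[n0 /eqP].
Qed.

Lemma order_opt_dvd x k : (0 < k)%N -> x ^+ k = 1 ->
  exists2 n, order_opt x = Some n & n %| k.
Proof.
move=> k0 xk; rewrite /order_opt /least_opt; case: pselect => [ex|[]]; last first.
  by exists k; rewrite k0 xk eqxx.
exists (ex_minn ex) => //; case: ex_minnP => n /andP[n0 /eqP xn] nmin.
rewrite /dvdn -leqn0 leqNgt; apply/negP => r0.
suff: (n <= k %% n)%N by rewrite leqNgt ltn_mod n0.
apply: nmin; rewrite r0 /=.
by move: xk; rewrite {1}(divn_eq k n) expgnDr mulnC expgnA xn expg1n mul1g => ->.
Qed.

Lemma order_opt1 : order_opt (1 : G) = Some 1%N.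
Proof.
have [|n -> ] := @order_opt_dvd 1 1%N isT; first exact: expg1n.
by rewrite dvdn1 => /eqP->.
Qed.

Lemma order_opt_ge2 x k : order_opt x = Some k -> x != 1 -> (1 < k)%N.
Proof. by case: k => [|[|k]] /order_optP[]// _; rewrite expg1 => ->; case/eqP. Qed.

Lemma order_optV x : order_opt x^-1 = order_opt x.
Proof.
by congr least_opt; apply/funext => k; rewrite expVgn invg_eq1.
Qed.

End Order.

Section OrderRelators.
Variables (G : groupType) (X : set G).
Hypothesis X2 : forall x, X x -> x * x = 1.

Definition order_relators : set (word X) :=
  coxeter_relators (fun a b : X => order_opt (val a * val b)).

(** The exponent k is a multiple of the order of a b, and the power with exponent
    the order is itself a relator. *)
Lemma pres_eq_order (a b : X) k : (val a * val b) ^+ k = 1 ->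
  pres_eq order_relators (flatten (nseq k [:: (a, false); (b, false)])) [::].
Proof.
case: k => [|k] abk; first exact: pres_refl.
have [n ordn /dvdnP[q ->]] := order_opt_dvd (ltn0Sn k) abk.
have -> : flatten (nseq (q * n) [:: (a, false); (b, false)]) =
    flatten (nseq q (flatten (nseq n [:: (a, false); (b, false)]))).
  by elim: q => //= q IHq; rewrite mulSn nseqD flatten_cat IHq.
by apply: pres_eq_pow; apply: pres_relator; exists a, b, n.
Qed.

(** The orders of the products of two involutions form a Coxeter matrix: b a is the
    inverse of a b, and a b = 1 only when a = b.  The order relators hold in G by
    construction, so only their sufficiency has to be assumed. *)
Lemma coxeter_system_order :
  (forall g, exists w, eval_word (fun s : X => val s) w = g) ->
  (forall w, eval_word (fun s : X => val s) w = 1 ->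
     pres_eq order_relators w [::]) ->
  coxeter_system X.
Proof.
move=> genX relX; exists (fun a b : X => order_opt (val a * val b)); split.
  have XV (a : X) : (val a)^-1 = val a.
    exact/mulg1_eq/X2/set_valP.
  split=> [a|a b|a b neq_ab].
  - by rewrite X2 ?order_opt1//; apply: set_valP.
  - by rewrite -order_optV invgM !XV.
  - case E: order_opt => [k|] //; apply: order_opt_ge2 E _.
    by rewrite mulg_eq1 XV; apply: contra_notN neq_ab => /eqP/val_inj.
split=> // w; split; first exact: relX.
move=> w1; rewrite -(eval_word_nil (fun s : X => val s)).
apply: eval_word_eq_pres w1 => _ [a [b [k [/order_optP[_ abk] ->]]]].
by rewrite eval_word_pow eval_word2.
Qed.

End OrderRelators.

Arguments order_relators {G} X _.

(** * Collapsing edges of a Cayley graph *)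

Section Collapse.
Variables (G : groupType) (S C : set G).

Lemma collapse_class_cayley g :
  collapse_class C (cayley S) g = lcoset g (gen (S `&` C)).
Proof.
apply/seteqP; split=> x; rewrite /collapse_class /=.
  move=> gx; exists (g^-1 * x); last by rewrite mulVKg.
  elim: gx => {g x} [x y [_ _ [c Cc [Sc xy]]]|x|x y _ IH|x y z _ IHx _ IHy] /=.
  - by rewrite xy; apply: sub_gen.
  - by rewrite mulVg gpred1.
  - by rewrite -[x in _ * x]invgK -invgM gpredV.
  - by rewrite -(mulVKg y z) mulgA gpredM.
move=> [h]; rewrite /= => hSC <-; move: g.
elim/gen_ind: h / hSC => [g|h h' IH IH' g|h IH g|c [Sc Cc] g].
- by rewrite mulg1; apply: rst_refl.
- by rewrite mulgA; apply: rst_trans (IH g) (IH' _).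
- by apply: rst_sym; have := IH (g * h^-1); rewrite mulgVK.
- by apply: rst_step; split=> //; exists c => //; split; rewrite ?mulKg.
Qed.

End Collapse.

(** * The retraction onto the complementary parabolic subgroup *)

Lemma retraction_exists (W : groupType) (S T : set W) (m : S -> S -> option nat) :
  coxeter_system_of m ->
  (forall t s : S, T (val t) -> ~ T (val s) -> even_or_infinite (m s t)) ->
  exists phi : UMagmaMorphism.type W (subgroup_type (gen (S `\` T) : groupClosed W)),
    (forall p, phi (val p) = p) /\ (forall s : S, T (val s) -> phi (val s) = 1).
Proof.
move=> hW m_even; have [[_ msym _] [genS m_rel]] := hW.
pose P : groupClosed W := gen (S `\` T).
have memP (s : S) : ~ T (val s) -> val s \in P.
  by move=> nTs; apply: sub_gen; split=> //; apply: set_valP.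
pose h (s : S) : subgroup_type P :=
  if pselect (T (val s)) is right nTs then SubgroupElt (memP s nTs) else 1.
have hT s : T (val s) -> h s = 1 by rewrite /h; case: pselect.
have hNT s : ~ T (val s) -> val (h s) = val s by rewrite /h; case: pselect.
have [phi phih] : exists phi : UMagmaMorphism.type W (subgroup_type P),
    forall s : S, phi (val s) = h s.
  apply: (presentation_lift (conj genS m_rel)) => r Rr.
  have h2 s : ~ T (val s) -> h s * h s = 1.
    move=> nTs; apply: val_inj.
    by rewrite valM val1 hNT // (coxeter_involution _ hW).
  have r1 : eval_word (fun s : S => val s) r = 1.
    by apply/m_rel; apply: pres_relator.
  case: Rr r1 => s [t [k [mst ->]]].
  rewrite !eval_word_pow !eval_word2.
  have even_pow (x : subgroup_type P) : x * x = 1 -> ~~ odd k -> x ^+ k = 1.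
    by move=> x2 /even_halfK <-; rewrite -muln2 mulnC expgnA expg2 x2 expg1n.
  have [Ts|nTs] := pselect (T (val s)); have [Tt|nTt] := pselect (T (val t)).
  - by rewrite !hT // mulg1 expg1n.
  - move=> _; rewrite hT // mul1g even_pow //; first exact: h2.
    by have := m_even s t Ts nTt; rewrite msym mst.
  - move=> _; rewrite (hT t) // mulg1 even_pow //; first exact: h2.
    by have := m_even t s Tt nTs; rewrite mst.
  - move=> st1; apply: val_inj; rewrite gmulfXn val1 -st1.
    have hst : val (h s * h t) = val s * val t by rewrite valM !hNT.
    by rewrite -hst.
exists phi; split=> [p|s Ts]; last by rewrite phih hT.
apply: val_inj; elim/gen_ind: (val p) / (valP p) => {p} [|x y xE yE|x xE|x [Sx nTx]].
- by rewrite gmulf1 val1.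
- by rewrite gmulfM valM xE yE.
- by rewrite -[in RHS]xE gmulfV [LHS]gmulfV.
- have := phih (SigSub (mem_set Sx)); rewrite /= => ->.
  exact: (hNT (SigSub (mem_set Sx))).
Qed.

Section Retraction.
Variables (W : groupType) (S T : set W).

Local Notation P := (gen (S `\` T) : groupClosed W).
Local Notation N := (ncl [set` gen T] : groupClosed W).
Local Notation ST_N := ([set x | conj_gens S T (val x)] : set (subgroup_type N)).

Lemma conj_gens_sub_ncl : conj_gens S T `<=` [set` N].
Proof.
by move=> _ [p _ [t Tt <-]]; apply: ncl_normal; apply: sub_ncl; apply: sub_gen.
Qed.

Lemma conj_gens_mem (p : subgroup_type P) t :
  T t -> conj_gens S T (val p * t * (val p)^-1).
Proof. by move=> Tt; exists (val p); [exact: valP | exists t]. Qed.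

Variable phi : UMagmaMorphism.type W (subgroup_type P).
Hypothesis phiP : forall p, phi (val p) = p.
Hypothesis phiT : forall t, T t -> phi t = 1.

Lemma retractionP x : x \in P -> val (phi x) = x.
Proof. by move=> Px; rewrite -[in LHS](SubK (subgroup_type P) Px) phiP. Qed.

Lemma retraction_ncl x : x \in N -> phi x = 1.
Proof.
elim/ncl_ind => {x} [|x y x1 y1|x x1|x|g x x1].
- exact: gmulf1.
- by rewrite gmulfM x1 y1 mulg1.
- by rewrite gmulfV x1 invg1.
- elim/gen_ind => {x} [|x y x1 y1|x x1|x]; last exact: phiT.
  + exact: gmulf1.
  + by rewrite gmulfM x1 y1 mulg1.
  + by rewrite gmulfV x1 invg1.
- by rewrite gmulfM gmulfV gmulfM x1 mulg1 mulgV.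
Qed.

(** * Reidemeister-Schreier rewriting along the retraction *)

Definition conj_gen (p : subgroup_type P) (t : W) (Tt : T t) : ST_N :=
  let pt := conj_gens_mem p Tt in
  SigSub (mem_set (pt : ST_N (SubgroupElt (conj_gens_sub_ncl pt)))).

Local Notation evalS := (eval_word (fun s : S => val s)).
Local Notation evalN := (eval_word (fun a : ST_N => val a)).

Lemma retraction_letterT (s : S) b : T (val s) -> phi (evalS [:: (s, b)]) = 1.
Proof.
by move=> Ts; rewrite eval_word1; case: b; rewrite ?gmulfV phiT ?invg1.
Qed.

Lemma retraction_letterNT (s : S) b :
  ~ T (val s) -> val (phi (evalS [:: (s, b)])) = evalS [:: (s, b)].
Proof.
move=> nTs; have Ps : val s \in P by apply: sub_gen; split=> //; apply: set_valP.
by rewrite retractionP // eval_word1; case: b; rewrite ?gpredV.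
Qed.

(** The subgroup P itself is a set of coset representatives of N, and p is the
    representative of the part of the word already read.  Letters outside T yield
    the trivial Schreier generator p s (p s)^-1, which is omitted. *)
Fixpoint schreier (p : subgroup_type P) (u : word S) : word ST_N :=
  if u is (s, b) :: u' then
    (if pselect (T (val s)) is left Ts then [:: (conj_gen p Ts, b)] else [::])
      ++ schreier (p * phi (evalS [:: (s, b)])) u'
  else [::].

(** Reading a letter of T leaves p unchanged, as phi kills it. *)
Lemma schreier_consT p (s : S) b u (Ts : T (val s)) :
  schreier p ((s, b) :: u) = (conj_gen p Ts, b) :: schreier p u.
Proof.
rewrite /= -/(evalS [:: (s, b)]) retraction_letterT // mulg1.
by case: pselect => // Ts'; rewrite (Prop_irrelevance Ts' Ts).
Qed.

Lemma schreier_consNT p (s : S) b u : ~ T (val s) ->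
  schreier p ((s, b) :: u) = schreier (p * phi (evalS [:: (s, b)])) u.
Proof. by move=> nTs /=; case: pselect. Qed.

Lemma schreier_cat p u v :
  schreier p (u ++ v) = schreier p u ++ schreier (p * phi (evalS u)) v.
Proof.
elim: u p => [|[s b] u IHu] p; first by rewrite eval_word_nil gmulf1 mulg1.
rewrite cat_cons /= IHu -catA; congr (_ ++ (_ ++ schreier _ _)).
by rewrite [in RHS]eval_word_cons gmulfM mulgA.
Qed.

(** The product telescopes: a letter x read in state p contributes
    p x (p phi(x))^-1, which is 1 when x lies in P. *)
Lemma eval_schreier p u :
  val (evalN (schreier p u)) = val p * evalS u / (val p * val (phi (evalS u))).
Proof.
elim: u p => [|[s b] u IHu] p.
  by rewrite !eval_word_nil gmulf1 val1 !mulg1 mulgV.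
rewrite [in RHS]eval_word_cons gmulfM valM.
have [Ts|nTs] := pselect (T (val s)).
  rewrite (schreier_consT _ _ _ Ts) eval_word_cons valM IHu retraction_letterT //.
  rewrite val1 mul1g !eval_word1 !mulgA; congr (_ * _ / _).
  by case: b; rewrite ?gmulfV /= ?invgM ?invgK ?mulgA mulgVK.
by rewrite schreier_consNT // IHu valM retraction_letterNT // !mulgA.
Qed.

Lemma schreier_pow p u k : phi (evalS u) = 1 ->
  schreier p (flatten (nseq k u)) = flatten (nseq k (schreier p u)).
Proof.
by move=> u1; elim: k => //= k IHk; rewrite schreier_cat u1 mulg1 IHk.
Qed.

(** Since erasing the letters of T does not change the image under phi, this turns
    any word for an element of P into a word for it over S \ T. *)
Definition eraseT (u : word S) := [seq a <- u | `[< ~ T (val a.1) >]].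

Lemma eval_eraseT u : evalS (eraseT u) = val (phi (evalS u)).
Proof.
elim: u => [|[s b] u IHu]; first by rewrite eval_word_nil gmulf1.
rewrite [in RHS]eval_word_cons gmulfM valM -IHu.
have [Ts|nTs] := pselect (T (val s)); rewrite /eraseT /=.
  by rewrite (asboolF (fun nTs => nTs Ts)) retraction_letterT // mul1g.
by rewrite (asboolT nTs) retraction_letterNT // -eval_word_cons.
Qed.

Lemma schreier_eraseT p u : schreier p (eraseT u) = [::].
Proof.
elim: u p => [//|[s b] u IHu] p; rewrite /eraseT /=.
have [Ts|nTs] := pselect (T (val s)).
  by rewrite (asboolF (fun nTs => nTs Ts)).
by rewrite (asboolT nTs) schreier_consNT.
Qed.

Hypothesis genS : forall g, exists w, evalS w = g.

Lemma schreier_gen x : phi x = 1 ->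
  exists w : word ST_N, val (evalN w) = x.
Proof.
have [u <-] := genS x => u1; exists (schreier 1 u).
by rewrite eval_schreier u1 val1 mulg1 divg1 mul1g.
Qed.

Lemma retraction_ker x : x \in N <-> phi x = 1.
Proof.
split=> [|/schreier_gen[w <-]]; [exact: retraction_ncl | exact: valP].
Qed.

Lemma gen_conj_gens : gen (conj_gens S T) =i N.
Proof.
move=> x; apply/idP/idP => [/genP|/retraction_ncl/schreier_gen[w <-]].
  by apply; apply: conj_gens_sub_ncl.
elim: w => [|[a b] w IHw]; first by rewrite eval_word_nil val1 gpred1.
rewrite eval_word_cons valM gpredM // eval_word1.
have STa : val (val a) \in gen (conj_gens S T) by apply/sub_gen/(set_valP a).
by case: b; rewrite ?gmulfV ?gpredV.
Qed.

(** * The Coxeter system of the kernel *)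

Hypothesis subTS : T `<=` S.

(** The letter q t q^-1 comes from a word for q, the letter t and a word for q^-1;
    the first and the last have no letter in T, so they only move the state, to q
    and back to 1. *)
Lemma schreier_surj w : exists2 u, schreier 1 u = w & phi (evalS u) = 1.
Proof.
elim: w => [|[a b] w [u uw u1]].
  by exists [::]; rewrite ?eval_word_nil ?gmulf1.
have [q Pq [t Tt aE]] := set_valP a.
have [v vq] := genS q; have [v' vq'] := genS q^-1.
have phiq : phi q = SubgroupElt Pq by exact: (phiP (SubgroupElt Pq)).
have [Pv Pv'] : phi (evalS v) = SubgroupElt Pq /\
    phi (evalS v') = (SubgroupElt Pq)^-1.
  by rewrite vq vq' gmulfV phiq.
pose s : S := SigSub (mem_set (subTS Tt)); have Ts : T (val s) by [].
have e : evalS (eraseT v) = q /\ evalS (eraseT v') = q^-1.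
  by rewrite !eval_eraseT Pv Pv' gmulfV.
exists (eraseT v ++ (s, b) :: eraseT v' ++ u).
  rewrite schreier_cat (schreier_consT _ _ _ Ts) schreier_cat !schreier_eraseT.
  rewrite !cat0s e.1 e.2 mul1g gmulfV mulgV uw; congr ((_, _) :: _).
  by apply/val_inj/val_inj; rewrite /= -aE phiq.
rewrite eval_word_cat eval_word_cons !eval_word_cat e.1 e.2 !gmulfM u1 mulg1.
by rewrite retraction_letterT // mul1g gmulfV mulgV.
Qed.

Variable m : S -> S -> option nat.
Hypothesis m_sys : coxeter_system_of m.
Hypothesis m_even :
  forall t s : S, T (val t) -> ~ T (val s) -> even_or_infinite (m s t).

Lemma conj_gens_involution (x : subgroup_type N) : ST_N x -> x * x = 1.
Proof.
move=> [q Pq [t Tt xE]]; apply: val_inj; rewrite valM val1 -xE.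
rewrite !mulgA mulgVK -(mulgA q).
have /= -> := coxeter_involution (SigSub (mem_set (subTS Tt))) m_sys.
by rewrite mulg1 mulgV.
Qed.

Local Notation conj_relators := (order_relators ST_N).

(** A rewritten relator has value 1 by [eval_schreier], so as soon as it is a power
    of a two-letter word a b, the order of a b divides the exponent. *)
Lemma schreier_relator_pow p r a b j : evalS r = 1 ->
  schreier p r = flatten (nseq j [:: (a, false); (b, false)]) ->
  pres_eq conj_relators (schreier p r) [::].
Proof.
move=> r1 rE; rewrite rE; apply: pres_eq_order; apply: val_inj.
have := eval_schreier p r; rewrite r1 gmulf1 val1 !mulg1 mulgV rE.
by rewrite eval_word_pow eval_word2.
Qed.

Lemma schreier_relator p r : coxeter_relators m r ->
  pres_eq conj_relators (schreier p r) [::].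
Proof.
move=> Rr; have [[_ msym _] [_ m_rel]] := m_sys.
have r1 : evalS r = 1 by apply/m_rel; apply: pres_relator.
case: Rr => s [t [k [mst rE]]].
(* In the mixed cases only (s t)^2, and not s t, returns to the state p. *)
have even_pow : ~~ odd k -> r = flatten
    (nseq k./2 [:: (s, false); (t, false); (s, false); (t, false)]).
  move=> ke; rewrite rE -[in LHS](even_halfK ke); elim: k./2 => // n IHn.
  by rewrite doubleS /= IHn.
have eval4 : evalS [:: (s, false); (t, false); (s, false); (t, false)] =
    val s * val t * val s * val t.
  by rewrite /eval_word !big_cons big_nil /= mulg1 !mulgA.
have [Ts|nTs] := pselect (T (val s)); have [Tt|nTt] := pselect (T (val t)).
- apply: (@schreier_relator_pow _ _ (conj_gen p Ts) (conj_gen p Tt) k) => //.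
  rewrite rE schreier_pow ?schreier_consT // eval_word_cons gmulfM.
  by rewrite !retraction_letterT // mulg1.
- have /even_pow rE' : even_or_infinite (Some k) by rewrite -mst msym; exact: m_even.
  pose q := p * phi (evalS [:: (t, false)]).
  apply: (@schreier_relator_pow _ _ (conj_gen p Ts) (conj_gen q Ts) k./2) => //.
  rewrite rE' schreier_pow.
    by do 2!rewrite (schreier_consT _ _ _ Ts) (schreier_consNT _ _ _ nTt).
  by rewrite eval4 !gmulfM (phiT Ts) mul1g mulg1 -gmulfM
    (coxeter_involution _ m_sys) gmulf1.
- have /even_pow rE' : even_or_infinite (Some k) by rewrite -mst; exact: m_even.
  pose q := p * phi (evalS [:: (s, false)]).
  have s2 : phi (evalS [:: (s, false)]) * phi (evalS [:: (s, false)]) = 1.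
    by rewrite -gmulfM !eval_word1 (coxeter_involution _ m_sys) gmulf1.
  apply: (@schreier_relator_pow _ _ (conj_gen q Tt) (conj_gen p Tt) k./2) => //.
  rewrite rE' schreier_pow.
    do 2!rewrite (schreier_consNT _ _ _ nTs) (schreier_consT _ _ _ Tt).
    by rewrite -(mulgA p) s2 mulg1.
  by rewrite eval4 !gmulfM (phiT Tt) !mulg1 -gmulfM
    (coxeter_involution _ m_sys) gmulf1.
- suff -> : schreier p r = [::] by apply: pres_refl.
  rewrite rE; elim: {mst rE even_pow} k p => // k IHk p.
  by rewrite [flatten _]/= !schreier_consNT // IHk.
Qed.

(** The state has to be arbitrary: in a product u v, the word v is read in the
    state reached after u. *)
Lemma schreier_pres_eq u v : pres_eq (coxeter_relators m) u v ->
  forall p, pres_eq conj_relators (schreier p u) (schreier p v).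
Proof.
have [_ [_ m_rel]] := m_sys; have rel1 r : coxeter_relators m r -> evalS r = 1.
  by move=> Rr; apply/m_rel; apply: pres_relator.
elim=> {u v} [u p|u v _ IH p|u v w _ IHu _ IHv p|u u' v v' uu' IHu _ IHv p|s b p|r Rr p].
- exact: pres_refl.
- exact/pres_sym/IH.
- exact: pres_trans (IHu p) (IHv p).
- by rewrite !schreier_cat (eval_word_eq_pres rel1 uu'); apply: pres_cat.
- have [Ts|nTs] := pselect (T (val s)).
    by rewrite !schreier_consT; apply: pres_cancel.
  by rewrite !schreier_consNT //; apply: pres_refl.
- exact: schreier_relator.
Qed.

Lemma coxeter_system_conj_gens : coxeter_system ST_N.
Proof.
apply: coxeter_system_order => [x|x|w w1]; first exact: conj_gens_involution.
  have [w wx] := schreier_gen (retraction_ncl (valP x)).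
  by exists w; apply: val_inj.
have [u uw u1] := schreier_surj w; rewrite -uw.
have [_ [_ m_rel]] := m_sys; apply: (schreier_pres_eq (v := [::])); apply/m_rel.
have := eval_schreier 1 u.
by rewrite uw w1 u1 !val1 mulg1 divg1 mul1g.
Qed.

(** * The collapsed Cayley graph *)

Lemma lcoset_retraction_inj (x y : W) : phi x = 1 -> phi y = 1 ->
  lcoset x P = lcoset y P -> x = y.
Proof.
move=> x1 y1 xy; have : lcoset y P x.
  by rewrite -xy; exists 1; rewrite ?mulg1 //= gpred1.
move=> [h /= Ph yh]; move: (x1); rewrite -yh gmulfM y1 mul1g.
by move=> /(congr1 val); rewrite retractionP // val1 => ->; rewrite mulg1.
Qed.

Lemma cayley_collapse :
  graph_isomorphism (cayley ST_N) (collapse (~` T) (cayley S))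
    (fun g => lcoset (val g) P).
Proof.
have cosetE g : collapse_class (~` T) (cayley S) g = lcoset g P.
  exact: collapse_class_cayley.
have phiN (x : subgroup_type N) : phi (val x) = 1 := retraction_ncl (valP x).
split; [split|].
- by move=> x _ /=; exists (val x); rewrite ?cosetE.
- by move=> x y _ _ /(lcoset_retraction_inj (phiN _) (phiN _)) /val_inj.
- move=> _ [g _ <-].
  (* The point of N in the coset gP. *)
  have Ng : g / val (phi g) \in N.
    by apply/retraction_ker; rewrite gmulfM gmulfV phiP mulgV.
  exists (SubgroupElt Ng) => //; rewrite cosetE /=.
  apply/seteqP; split=> _ [h /= Ph <-].
    by exists ((val (phi g))^-1 * h); rewrite ?mulgA //= gpredM ?gpredV ?(valP (phi g)).
  by exists (val (phi g) * h); rewrite ?mulgA ?mulgVK //= gpredM // (valP (phi g)).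
move=> x y _ _; split.
  move=> [c [[p Pp [t Tt cE]] xy]]; exists t; split; first by move/(_ Tt).
  exists (val x * p), (val y * p); split; [by exists p | by exists p |].
  split; first exact: subTS.
  rewrite invgM -mulgA (mulgA (val x)^-1).
  have -> : (val x)^-1 * val y = p * t * p^-1 by rewrite cE -xy valM gmulfV.
  by rewrite !mulgA mulVg mul1g mulgVK.
move=> [t [nnTt [_ [_ [[p /= Pp <-] [q /= Pq <-] [St]]]]]].
have Tt : T t := contrapT nnTt.
rewrite invgM => e.
(* The images of x, y and t under phi are trivial, so phi sends e to
   p^-1 q = 1. *)
have pq : p = q.
  have := congr1 phi e; rewrite (phiT Tt) !gmulfM !gmulfV (phiN x) (phiN y).
  rewrite invg1 mulg1 mul1g => /mulg1_eq; rewrite invgK => /(congr1 val).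
  by rewrite !retractionP.
exists (x^-1 * y); split=> //; exists p => //; exists t => //.
by rewrite -e pq valM gmulfV !mulgA mulgK mulgV mul1g.
Qed.

End Retraction.

Theorem proposition2p1 (W : groupType) (S : set W) (m : S -> S -> option nat)
    (T : set W)
    (hW : coxeter_system_of m)
    (hTS : T `<=` S)
    (hT : forall t s : S, T (val t) -> ~ T (val s) -> even_or_infinite (m s t)) :
  let WT : {pred W} := gen T in
  let N : groupClosed W := ncl [set` WT] in
  let P : groupClosed W := gen (S `\` T) in
  let ST : set W := conj_gens S T in
  let ST_N : set (subgroup_type N) := [set x | ST (val x)] in
  (exists phi : {multiplicative W -> subgroup_type P},
     [/\ forall x : subgroup_type P, phi (val x) = x,
         forall x : W, x \in WT -> phi x = 1 &
         forall x : W, x \in N <-> phi x = 1]) /\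
  gen ST =i N /\
  graph_isomorphism (cayley ST_N) (collapse (~` T) (cayley S))
    (fun g : subgroup_type N => lcoset (val g) P) /\
  coxeter_system ST_N.
Proof.
have [phi [phiP phiTS]] := retraction_exists hW hT.
have phiT t : T t -> phi t = 1.
  by move=> Tt; apply: (phiTS (SigSub (mem_set (hTS _ Tt)))).
have [_ [genS _]] := hW.
move=> WT N P ST ST_N; split.
  exists phi; split=> // x; last exact: retraction_ker.
  by move=> WTx; apply: retraction_ncl => //; apply: sub_ncl.
split; first exact: (gen_conj_gens phiP phiT genS).
split; first exact: (cayley_collapse phiP phiT genS hTS).
exact: (coxeter_system_conj_gens phiP phiT genS hTS hW hT).
Qed.
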